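(* Assume that each $f_i:\mathbb{R}^d\to\mathbb{R}$ ($i=1,\dots,N$) is $L$-smooth, that $\sigma_*^2:=\sup_{x\in\mathbb{R}^d}\|\Sigma_{\mathrm{MB}}(x)\|_S<\infty$, and that $f$ is weakly-quasi-convex: there is $\tau>0$ such that $\langle\nabla f(x),x-x^\star\rangle\ge\tau(f(x)-f(x^\star))$ for all $x\in\mathbb{R}^d$. Let $\{x_k\}_{k\ge0}$ be the iterates of mini-batch SGD, $x_{k+1}=x_k-\eta_k\,\mathcal{G}_{\mathrm{MB}}(x_k,k)$, started at $x_0\in\mathbb{R}^d$. For $k\ge0$ let $\tilde k\in\{0,\dots,k\}$ be a random index (drawn independently of the iterates) equal to $j$ with probability $\psi_j/\varphi_{k+1}$ for $j\in\{0,\dots,k\}$. If $0<h\le\frac{\tau}{2L}$, then $$\mathbb{E}\left[f(x_{\tilde k})-f(x^\star)\right]\le\frac{\|x_0-x^\star\|^2}{\tau\,(h\varphi_{k+1})}+\frac{d\,h\,\sigma_*^2}{\tau\,(h\varphi_{k+1})}\sum_{i=0}^k\frac{\psi_i^2}{b_i}\,h .$$ Moreover, if $0<h\le\frac2L-\frac1{\tau L}$, then for all $k\ge0$, $$\mathbb{E}\left[f(x_{k+1})-f(x^\star)\right]\le\frac{\|x_0-x^\star\|^2}{2\,\tau\,(h\varphi_{k+1})}+\frac{h\,d\,\sigma_*^2}{2\,\tau\,(h\varphi_{k+1})}\sum_{i=0}^k\bigl(1+\tau\,h\varphi_{i+1}\,L\bigr)\frac{\psi_i^2}{b_i}\,h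 .$$
   Context: $f_1,\dots,f_N:\mathbb{R}^d\to\mathbb{R}$ are continuously differentiable, $f:=\frac1N\sum_{i=1}^Nf_i$, and $x^\star\in\mathbb{R}^d$ is a global minimizer of $f$. A differentiable function $g$ is $L$-smooth if $\|\nabla g(x)-\nabla g(y)\|\le L\|x-y\|$ for all $x,y$. $\|\cdot\|$ is the Euclidean norm and $\|\cdot\|_S$ the spectral norm. The learning rates $(\eta_k)_{k\ge0}$ form a deterministic non-increasing sequence of positive numbers; $h:=\eta_0$, $\psi_k:=\eta_k/h$, and $\varphi_{k+1}:=\sum_{i=0}^k\psi_i$. The mini-batch gradient estimator is $\mathcal{G}_{\mathrm{MB}}(x_k,k):=\frac1{b_k}\sum_{i_k\in\Omega_k}\nabla f_{i_k}(x_k)$, where the $b_k\ge1$ indices in the mini-batch $\Omega_k$ are sampled, at each iteration, independently, uniformly and with replacement from $\{1,\dots,N\}$ (independently of the past). The one-sample covariance is $$\Sigma_{\mathrm{MB}}(x):=\frac1N\sum_{i=1}^N(\nabla f(x)-\nabla f_i(x))(\nabla f(x)-\nabla f_i(x))^T .$$ *)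

(* Defs.v *)
From HB Require Import structures.
From mathcomp Require Import all_boot all_order all_algebra finmap.
From mathcomp Require Import all_classical all_reals all_analysis.

Set Implicit Arguments.
Unset Strict Implicit.
Unset Printing Implicit Defensive.

Import Order.TTheory GRing.Theory Num.Theory.
Import numFieldNormedType.Exports.

Local Open Scope classical_set_scope.
Local Open Scope ring_scope.

Section Euclidean.
Context {R : realType} {d : nat}.
Implicit Types (u v x y : 'cV[R]_d) (f : 'cV[R]_d -> R).

Definition inner u v : R := \sum_(i < d) u i 0 * v i 0.

(* The norm `|u| of the library on matrices is the sup norm; it induces the
   same topology and the same notion of differentiability as enorm. *)
Definition enorm u : R := Num.sqrt (inner u u).

Definition spectral_norm (A : 'M[R]_d) : R :=
  sup [set enorm (A *m v) | v in [set v : 'cV[R]_d | enorm v <= 1]].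

(* Vector of partial derivatives; only meaningful where f is differentiable. *)
Definition grad f x : 'cV[R]_d := \col_(i < d) 'D_(delta_mx i 0) f x.

Definition continuously_differentiable f : Prop :=
  (forall x, differentiable f x) /\ continuous (grad f).

Definition smooth (L : R) f : Prop :=
  (forall x, differentiable f x) /\
  (forall x y, enorm (grad f x - grad f y) <= L * enorm (x - y)).

Definition global_minimizer f x : Prop := forall y, f x <= f y.

Definition weakly_quasi_convex (tau : R) f (xstar : 'cV[R]_d) : Prop :=
  forall x, inner (grad f x) (x - xstar) >= tau * (f x - f xstar).

End Euclidean.

Section FiniteSum.
Context {R : realType} {d N : nat}.
Variable fs : 'I_N -> 'cV[R]_d -> R.

Definition avg (x : 'cV[R]_d) : R := N%:R^-1 * \sum_(i < N) fs i x.

Definition Sigma_MB (x : 'cV[R]_d) : 'M[R]_d :=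
  N%:R^-1 *: \sum_(i < N)
    ((grad avg x - grad (fs i) x) *m (grad avg x - grad (fs i) x)^T).

Definition sigma2_star : \bar R :=
  ereal_sup [set (spectral_norm (Sigma_MB x))%:E | x in [set: 'cV[R]_d]].

End FiniteSum.

Section LearningRates.
Context {R : realType}.
Variable eta : nat -> R.

Definition psi (k : nat) : R := eta k / eta 0%N.

Definition phi (n : nat) : R := \sum_(i < n) psi i.

End LearningRates.

Section Independence.
Context {R : realType} {disp : measure_display} {T : measurableType disp}.
Variable P : probability T R.

Definition mutually_independent (I : choiceType) (F : I -> set (set T)) : Prop :=
  forall (J : {fset I}) (A : I -> set T),
    (forall i, i \in J -> F i (A i)) ->
    P (\bigcap_(i in [set` J]) A i) = (\prod_(i <- J) P (A i))%E.

Definition independent (F G : set (set T)) : Prop :=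
  forall A B, F A -> G B -> P (A `&` B) = (P A * P B)%E.

(* sigma-algebra generated by a random variable with values in a finite type,
   the latter being equipped with all its subsets *)
Definition sigma_fin (E : finType) (X : T -> E) : set (set T) :=
  preimage_set_system setT X setT.

(* sigma-algebra generated by a process with values in R^d, the latter being
   equipped with its Borel sets *)
Definition sigma_process (d : nat) (x : nat -> T -> 'cV[R]_d) : set (set T) :=
  <<s \bigcup_k preimage_set_system setT (x k)
        <<s [set U : set 'cV[R]_d | open U] >> >>.

Definition fin_random_variable (E : finType) (X : T -> E) : Prop :=
  sigma_fin X `<=` measurable.

End Independence.

Section SGD.
Context {R : realType} {disp : measure_display} {T : measurableType disp}.
Context {d N : nat}.
Variable P : probability T R.
Variables (fs : 'I_N -> 'cV[R]_d -> R) (b : nat -> nat).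
(* idx k j is the j-th index of the mini-batch Omega_k *)
Variable idx : forall k : nat, 'I_(b k) -> T -> 'I_N.

(* Joint independence over all pairs (k, j) covers both the independence
   inside each mini-batch and the independence of the past. *)
Definition uniform_iid_sampling : Prop :=
  [/\ forall k (j : 'I_(b k)), fin_random_variable (idx j),
      forall k (j : 'I_(b k)) (i : 'I_N),
        P (idx j @^-1` [set i]) = (N%:R^-1)%:E
    & mutually_independent P
        (fun s : {k : nat & 'I_(b k)} => sigma_fin (idx (tagged s)))].

Definition G_MB (x : 'cV[R]_d) (k : nat) (w : T) : 'cV[R]_d :=
  (b k)%:R^-1 *: \sum_(j < b k) grad (fs (idx j w)) x.

Fixpoint sgd (eta : nat -> R) (x0 : 'cV[R]_d) (k : nat) (w : T) : 'cV[R]_d :=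
  if k is k'.+1 then
    sgd eta x0 k' w - eta k' *: G_MB (sgd eta x0 k' w) k' w
  else x0.

End SGD.

Section RandomIndex.
Context {R : realType} {disp : measure_display} {T : measurableType disp}.
Context {d : nat}.
Variable P : probability T R.

Definition random_index (eta : nat -> R) (x : nat -> T -> 'cV[R]_d)
    (k : nat) (ktilde : T -> 'I_k.+1) : Prop :=
  [/\ fin_random_variable ktilde,
      forall j : 'I_k.+1,
        P (ktilde @^-1` [set j]) = (psi eta j / phi eta k.+1)%:E
    & independent P (sigma_fin ktilde) (sigma_process x)].

End RandomIndex.

(* Main.v *)
Require Import Defs.
From HB Require Import structures.
From mathcomp Require Import all_boot all_order all_algebra finmap.
From mathcomp Require Import all_classical all_reals all_analysis.
From mathcomp Require Import measurable_realfun ring lra.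

Set Implicit Arguments.
Unset Strict Implicit.
Unset Printing Implicit Defensive.

Import Order.TTheory GRing.Theory Num.Theory.
Import numFieldNormedType.Exports.

Local Open Scope classical_set_scope.
Local Open Scope ring_scope.

(** The iterate x_k depends only on the finitely many indices drawn before step k,
which by joint independence are uniformly distributed over a finite type of
histories. The expectation of a function of x_k is therefore a finite average
over histories ([integral_past]), and conditioning on the past is the
decomposition of such an average over a product ([mean_pair]). In what
follows, E denotes these averages and F(x) = f(x) - f(xstar) the gap.

For fixed x, the mini-batch gradient is unbiased, and its second moment is at
most |grad f(x)|^2 + d sigma2 / b: its variance is the trace of the covariance
divided by b, and the trace is at most d times the spectral norm
([mean_inner_batch_grad], [mean_sqr_batch_grad_le]).

For the random index, expand |x_(k+1) - xstar|^2. Weak quasi-convexity bounds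
the cross term by -2 eta_k tau F(x_k), and smoothness gives
|grad f|^2 <= 2 L F ([grad_sqr_le]). As 2 L eta_k <= tau,
[[
  E|x_(k+1) - xstar|^2 + tau eta_k E F(x_k)
    <= E|x_k - xstar|^2 + eta_k^2 d sigma2 / b_k,
]]
and summing over k bounds the weighted sum of the gaps ([sum_mean_gap_le]).
Independence of the random index turns the expected gap at that index into
the weighted sum ([integral_random_index]).

For the last iterate, let t_k = eta_0 + ... + eta_(k-1) and consider the
Lyapunov function tau t_k F(x_k) + |x_k - xstar|^2 / 2. The descent lemma
([smooth_descent]) for the first term and the expansion of the second one
leave, besides the noise, the multiple
eta_k (eta_k / 2 - tau t_(k+1) (1 - L eta_k / 2)) of |grad f(x_k)|^2. Since
t_(k+1) >= eta_k, the bound on the step size makes it nonpositive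
([lyapunov_step]), and the weight of F(x_0) is zero because t_0 = 0. *)

(** * Inner product, norm and spectral norm *)

Section InnerProduct.
Context {R : realType} {d : nat}.
Implicit Types u v w : 'cV[R]_d.

Lemma innerC u v : inner u v = inner v u.
Proof. by apply: eq_bigr => i _; rewrite mulrC. Qed.

Lemma innerDl u v w : inner (u + v) w = inner u w + inner v w.
Proof. by rewrite -big_split; apply: eq_bigr => i _; rewrite mxE mulrDl. Qed.

Lemma innerZl (a : R) u v : inner (a *: u) v = a * inner u v.
Proof. by rewrite mulr_sumr; apply: eq_bigr => i _; rewrite mxE mulrA. Qed.

Lemma innerDr u v w : inner u (v + w) = inner u v + inner u w.
Proof. by rewrite innerC innerDl !(innerC u). Qed.

Lemma innerZr (a : R) u v : inner u (a *: v) = a * inner u v.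
Proof. by rewrite innerC innerZl innerC. Qed.

Lemma innerNl u v : inner (- u) v = - inner u v.
Proof. by rewrite -scaleN1r innerZl mulN1r. Qed.

Lemma innerNr u v : inner u (- v) = - inner u v.
Proof. by rewrite innerC innerNl innerC. Qed.

Lemma inner_suml (I : Type) (r : seq I) (F : I -> 'cV[R]_d) v :
  inner (\sum_(i <- r) F i) v = \sum_(i <- r) inner (F i) v.
Proof.
apply: (big_morph (fun u => inner u v)) => [u w|]; first exact: innerDl.
by rewrite -[0 in LHS](scale0r v) innerZl mul0r.
Qed.

Lemma inner_ge0 u : 0 <= inner u u.
Proof. by apply: sumr_ge0 => i _; exact: sqr_ge0. Qed.

Lemma enorm_ge0 u : 0 <= enorm u.
Proof. exact: sqrtr_ge0. Qed.

Lemma enorm_sqr u : enorm u ^+ 2 = inner u u.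
Proof. exact/sqr_sqrtr/inner_ge0. Qed.

Lemma enormZ (a : R) u : 0 <= a -> enorm (a *: u) = a * enorm u.
Proof.
move=> a0; rewrite /enorm innerZl innerZr mulrA sqrtrM ?mulr_ge0//.
by rewrite -expr2 sqrtr_sqr ger0_norm.
Qed.

Lemma inner_eq0 u : inner u u = 0 -> u = 0.
Proof.
move=> /eqP; rewrite psumr_eq0 => [/allP uu|i _]; last exact: sqr_ge0.
apply/colP => i; rewrite mxE; have /= := uu i (mem_index_enum _).
by rewrite mulf_eq0 orbb => /eqP.
Qed.

Lemma inner_le_enorm u v : inner u v <= enorm u * enorm v.
Proof.
have [/inner_eq0 v0|v0] := eqVneq (inner v v) 0.
  by rewrite v0 -(scale0r 0) innerZr mul0r mulr_ge0 ?enorm_ge0.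
have vv0 : 0 < inner v v by rewrite lt_def v0 inner_ge0.
(* |v|^2 times the component of u orthogonal to v *)
have := inner_ge0 (inner v v *: u - inner u v *: v).
rewrite !(innerDl, innerDr, innerNl, innerNr, innerZl, innerZr) (innerC v u) => H.
apply: le_trans (ler_norm _) _.
rewrite -ler_sqr ?nnegrE ?mulr_ge0 ?enorm_ge0// real_normK ?num_real//.
by rewrite exprMn !enorm_sqr -subr_ge0 -(pmulr_rge0 _ vv0); lra.
Qed.

Lemma enormD u v : enorm (u + v) <= enorm u + enorm v.
Proof.
rewrite -ler_sqr ?nnegrE ?addr_ge0 ?enorm_ge0//.
rewrite enorm_sqr !innerDl !innerDr (innerC v u) -!enorm_sqr.
by have := inner_le_enorm u v; nra.
Qed.

Lemma enorm_sum (I : Type) (r : seq I) (F : I -> 'cV[R]_d) :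
  enorm (\sum_(i <- r) F i) <= \sum_(i <- r) enorm (F i).
Proof.
elim: r => [|i r ih].
  by rewrite !big_nil -(scale0r 0) enormZ// mul0r.
by rewrite !big_cons (le_trans (enormD _ _))// lerD2l.
Qed.

Lemma coord_le_enorm u i : `|u i 0| <= enorm u.
Proof.
rewrite -sqrtr_sqr ler_wsqrtr// /inner (bigD1 i)//= expr2 lerDl.
by apply: sumr_ge0 => j _; exact: sqr_ge0.
Qed.

(** The unit coordinate vector e_i gives A_ii <= |A e_i| <= |A|. The supremum
defining the spectral norm is over a bounded set because the coordinates of a
vector of the unit ball are at most 1 in absolute value. *)
Lemma diag_le_spectral_norm (A : 'M[R]_d) i : A i i <= spectral_norm A.
Proof.
pose e : 'cV[R]_d := delta_mx i 0.
have e1 : enorm e <= 1.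
  rewrite /enorm /inner (bigD1 i)//= big1 => [|j /negbTE ji].
    by rewrite !mxE !eqxx mul1r addr0 sqrtr1.
  by rewrite !mxE ji mul0r.
have -> : A i i = (A *m e) i 0 by rewrite -colE mxE.
apply: (le_trans (ler_norm _)); apply: (le_trans (coord_le_enorm _ _)).
apply: ub_le_sup; last by exists e.
exists (Num.sqrt (\sum_(k < d) (\sum_(j < d) `|A k j|) ^+ 2)) => _ [v v1 <-].
rewrite ler_wsqrtr//; apply: ler_sum => k _; rewrite -expr2 -real_normK ?num_real//.
rewrite ler_sqr ?nnegrE//; last exact: sumr_ge0.
rewrite mxE (le_trans (ler_norm_sum _ _ _))//; apply: ler_sum => j _.
by rewrite normrM ler_piMr// (le_trans (coord_le_enorm _ _)).
Qed.

End InnerProduct.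

(** * Gradients and smoothness *)

Section Gradient.
Context {R : realType} {d : nat}.
Implicit Types (f : 'cV[R]_d -> R) (x y v : 'cV[R]_d).

Lemma derive_grad f x v : differentiable f x -> 'D_v f x = inner (grad f x) v.
Proof.
move=> df; rewrite deriveE//.
rewrite {1}(matrix_sum_delta v) linear_sum /inner; apply: eq_bigr => i _.
by rewrite big_ord1 linearZ/= mxE deriveE// mulrC.
Qed.

Lemma is_derive_segment f x v (t : R) : differentiable f (t *: v + x) ->
  is_derive t 1 (fun s => f (s *: v + x)) (inner (grad f (t *: v + x)) v).
Proof.
move=> dft.
have E : (fun h : R => h^-1 *: (((fun s => f (s *: v + x)) \o shift t) (h *: 1) -
      f (t *: v + x))) =
    (fun h : R => h^-1 *: ((f \o shift (t *: v + x)) (h *: v) - f (t *: v + x))).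
  by apply/funext => h /=; rewrite [h *: 1]mulr1 scalerDl addrA.
have dv : derivable f (t *: v + x) v by exact: diff_derivable.
apply: DeriveDef; first by rewrite /derivable E; exact: dv.
by rewrite -derive_grad// /derive E.
Qed.

(** The function t |-> f (x + t v) - t <grad f x, v> - t^2 L |v|^2 / 2 does not
increase on [0, 1]: by Cauchy-Schwarz and smoothness its derivative is
nonpositive. *)
Lemma smooth_descent (L : R) f x v : smooth L f ->
  f (x + v) <= f x + inner (grad f x) v + L / 2 * inner v v.
Proof.
move=> [df Lf].
pose g (t : R) := f (t *: v + x) - (t * inner (grad f x) v + t ^+ 2 * (L / 2 * inner v v)).
pose dg (t : R) := inner (grad f (t *: v + x)) v -
  (inner (grad f x) v + 2 * t * (L / 2 * inner v v)).
have gE (t : R) : is_derive t (1 : R) g (dg t).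
  apply: is_deriveB; last first.
    by apply: is_derive_eq; rewrite /GRing.scale/=; ring.
  exact: is_derive_segment.
have : g 1 <= g 0.
  apply: (@ler0_derive1_le_cc _ g 0 1); rewrite ?in_itv/= ?lexx ?ler01//.
  - move=> t t01; rewrite derive1E (@derive_val _ _ _ _ _ _ _ (gE t)) /dg.
    have t0 : 0 <= t by move: t01; rewrite in_itv/= => /andP[/ltW].
    have := inner_le_enorm (grad f (t *: v + x) - grad f x) v.
    rewrite innerDl innerNl => H1.
    have := Lf (t *: v + x) x; rewrite addrK enormZ// => H2.
    have := ler_wpM2r (enorm_ge0 v) H2 => H3; have := enorm_sqr v.
    nra.
  - by apply: continuous_subspaceT => t; apply/differentiable_continuous/derivable1_diffP.
rewrite /g scale1r scale0r add0r expr0n expr1n /= !mul0r !mul1r addr0 subr0 (addrC v) => H.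
lra.
Qed.

(** A gradient step of length 1 / L decreases f by at least
|grad f x|^2 / (2 L), yet f cannot fall below its minimum. *)
Lemma grad_sqr_le (L : R) f x xmin : 0 < L -> smooth L f ->
  global_minimizer f xmin ->
  inner (grad f x) (grad f x) <= 2 * L * (f x - f xmin).
Proof.
move=> L0 sf fmin.
have := smooth_descent x (- (L^-1 *: grad f x)) sf.
rewrite !(innerNl, innerNr, innerZl, innerZr) opprK.
set G := inner _ _ => H.
have := le_trans (fmin _) H => {}H.
have e : L / 2 * (L^-1 * (L^-1 * G)) = L^-1 * G / 2 by field; rewrite gt_eqF.
have {H}H : L^-1 * G <= 2 * (f x - f xmin) by rewrite e in H; lra.
by rewrite mulrAC -ler_pdivrMr// mulrC.
Qed.

End Gradient.

Section Average.
Context {R : realType} {d N : nat}.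
Variables (fs : 'I_N -> 'cV[R]_d -> R) (L : R).

Lemma avgE : avg fs = N%:R^-1 \*: \sum_(i < N) fs i.
Proof. by apply/funext => x; rewrite /avg fct_sumE. Qed.

Lemma grad_avg x : (forall i, differentiable (fs i) x) ->
  grad (avg fs) x = N%:R^-1 *: \sum_(i < N) grad (fs i) x.
Proof.
move=> df; apply/colP => i; rewrite !mxE summxE avgE.
have dfi j v : derivable (fs j) x v by exact: diff_derivable.
rewrite deriveZ; last exact: derivable_sum.
by rewrite derive_sum//; congr (_ *: _); apply: eq_bigr => j _; rewrite mxE.
Qed.

Lemma smooth_avg : (0 < N)%N -> (forall i, smooth L (fs i)) -> smooth L (avg fs).
Proof.
move=> N0 sf; have df i x : differentiable (fs i) x by case: (sf i).
split=> [x|x y].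
  by rewrite avgE; apply: differentiableZ; exact: differentiable_sum.
rewrite !grad_avg// -scalerBr -sumrB enormZ ?invr_ge0//.
rewrite ler_pdivrMl ?ltr0n// (le_trans (enorm_sum _ _))//.
rewrite -[X in X%:R * _](card_ord N) mulr_natl -sumr_const.
by apply: ler_sum => i _; case: (sf i).
Qed.

End Average.

(** * Averages over finite types *)

Section Mean.
Context {R : realType}.

Definition mean (E : finType) (g : E -> R) : R := #|E|%:R^-1 * \sum_e g e.

Section OneType.
Variable E : finType.
Implicit Types g : E -> R.

Lemma eq_mean g1 g2 : g1 =1 g2 -> mean g1 = mean g2.
Proof. by move=> g12; congr (_ * _); apply: eq_bigr => e _; exact: g12. Qed.

Lemma ler_mean g1 g2 : (forall e, g1 e <= g2 e) -> mean g1 <= mean g2.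
Proof. by move=> g12; rewrite ler_wpM2l ?invr_ge0// ler_sum. Qed.

Lemma meanD g1 g2 : mean (fun e => g1 e + g2 e) = mean g1 + mean g2.
Proof. by rewrite /mean big_split mulrDr. Qed.

Lemma meanZ (a : R) g : mean (fun e => a * g e) = a * mean g.
Proof. by rewrite /mean -mulr_sumr mulrCA. Qed.

Lemma mean_sum (I : Type) (r : seq I) (F : I -> E -> R) :
  mean (fun e => \sum_(i <- r) F i e) = \sum_(i <- r) mean (F i).
Proof. by rewrite /mean exchange_big mulr_sumr. Qed.

Lemma mean_cst (a : R) : (0 < #|E|)%N -> mean (fun _ : E => a) = a.
Proof.
move=> E0; rewrite /mean sumr_const -(mulr_natl a) mulrA mulVf ?mul1r//.
by rewrite pnatr_eq0 -lt0n.
Qed.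

End OneType.

Lemma mean_pair (E1 E2 : finType) (g : E1 * E2 -> R) :
  mean g = mean (fun e1 => mean (fun e2 => g (e1, e2))).
Proof.
rewrite meanZ /mean mulrA card_prod natrM invfM [X in X * _]mulrC; congr (_ * _).
by rewrite pair_big; apply: eq_bigr => -[].
Qed.

(** The values of a uniformly distributed finite function are independent and
uniformly distributed. *)
Lemma mean_ffun_prod (J E : finType) (F : J -> E -> R) :
  mean (fun s : {ffun J -> E} => \prod_j F j (s j)) = \prod_j mean (F j).
Proof.
rewrite /mean card_ffun natrX -bigA_distr_bigA big_split/=; congr (_ * _).
by rewrite prodr_const exprVn.
Qed.

Section FiniteFunction.
Variables (J E : finType).
Hypothesis E0 : (0 < #|E|)%N.

Lemma mean_ffun1 (j : J) (p : E -> R) :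
  mean (fun s : {ffun J -> E} => p (s j)) = mean p.
Proof.
have := mean_ffun_prod (fun i e => if i == j then p e else 1).
rewrite [in RHS](bigD1 j)//= eqxx big1 ?mulr1 => [<-|i /negbTE ij].
  apply: eq_mean => s; rewrite (bigD1 j)//= eqxx big1 ?mulr1// => i.
  by move=> /negbTE ->.
by rewrite ij mean_cst.
Qed.

Lemma mean_ffun2 (j k : J) (p q : E -> R) : k != j ->
  mean (fun s : {ffun J -> E} => p (s j) * q (s k)) = mean p * mean q.
Proof.
move=> kj.
have := mean_ffun_prod (fun i e => if i == j then p e else if i == k then q e else 1).
rewrite [in RHS](bigD1 j)//= eqxx [in RHS](bigD1 k)//= (negbTE kj) eqxx.
rewrite big1 ?mulr1 => [<-|i /andP[/negbTE -> /negbTE ->]]; last by rewrite mean_cst.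
apply: eq_mean => s; rewrite (bigD1 j)//= eqxx (bigD1 k)//= (negbTE kj) eqxx.
by rewrite big1 ?mulr1// => i /andP[/negbTE -> /negbTE ->].
Qed.

End FiniteFunction.

Section Batch.
Variables (n : nat) (E : finType).
Hypotheses (n0 : (0 < n)%N) (E0 : (0 < #|E|)%N).

Lemma mean_batch (p : E -> R) :
  mean (fun s : {ffun 'I_n -> E} => n%:R^-1 * \sum_j p (s j)) = mean p.
Proof.
rewrite meanZ mean_sum; under eq_bigr do rewrite mean_ffun1//.
by rewrite sumr_const card_ord -(mulr_natl (mean p)) mulrA mulVf ?mul1r// pnatr_eq0 -lt0n.
Qed.

(** The variance of an average of n independent centered samples: the cross
terms vanish. *)
Lemma mean_batch_sqr (p : E -> R) : mean p = 0 ->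
  mean (fun s : {ffun 'I_n -> E} => (n%:R^-1 * \sum_j p (s j)) ^+ 2) =
  n%:R^-1 * mean (fun e => p e ^+ 2).
Proof.
move=> p0.
under eq_mean do rewrite exprMn expr2 [X in _ * X]expr2 mulr_suml.
rewrite meanZ mean_sum (eq_bigr (fun=> mean (fun e => p e ^+ 2))) => [|j _].
  rewrite sumr_const card_ord -(mulr_natl (mean _)) mulrA; congr (_ * _).
  by rewrite -mulrA mulVf ?mulr1// pnatr_eq0 -lt0n.
under eq_mean do rewrite mulr_sumr.
rewrite mean_sum (bigD1 j)//= big1 => [|k kj]; last by rewrite mean_ffun2// p0 mul0r.
by rewrite addr0 -(@mean_ffun1 'I_n E E0 j).
Qed.

End Batch.
End Mean.

(** * Moments of the mini-batch gradient *)

Section MiniBatch.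
Context {R : realType} {d N : nat}.
Variables (fs : 'I_N -> 'cV[R]_d -> R) (n : nat).
Hypotheses (N0 : (0 < N)%N) (n0 : (0 < n)%N).
Hypothesis fs_diff : forall i x, differentiable (fs i) x.

Definition batch_grad x (s : {ffun 'I_n -> 'I_N}) : 'cV[R]_d :=
  n%:R^-1 *: \sum_(j < n) grad (fs (s j)) x.

Let I0 : (0 < #|'I_N|)%N. Proof. by rewrite card_ord. Qed.

Lemma mean_inner_batch_grad x v :
  mean (fun s => inner (batch_grad x s) v) = inner (grad (avg fs) x) v.
Proof.
under eq_mean do rewrite innerZl inner_suml.
rewrite (mean_batch n0 I0 (fun i => inner (grad (fs i) x) v)).
by rewrite grad_avg// innerZl inner_suml /mean card_ord.
Qed.

Lemma mean_sqr_batch_noise x c :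
  mean (fun s => (batch_grad x s - grad (avg fs) x) c 0 ^+ 2) =
  n%:R^-1 * Sigma_MB fs x c c.
Proof.
pose p (i : 'I_N) := (grad (fs i) x - grad (avg fs) x) c 0.
have pE s : (batch_grad x s - grad (avg fs) x) c 0 = n%:R^-1 * \sum_j p (s j).
  rewrite /p; under eq_bigr do rewrite mxE.
  rewrite big_split/= mulrDr sumr_const card_ord -(mulr_natl (_ c 0)) mulrA mulVf.
    by rewrite mul1r !mxE summxE.
  by rewrite pnatr_eq0 -lt0n.
under eq_mean do rewrite pE.
rewrite mean_batch_sqr//; last first.
  rewrite /p; under eq_mean do rewrite mxE.
  rewrite meanD mean_cst// [in X in _ + X]grad_avg// /mean card_ord !mxE summxE.
  by rewrite subrr.
rewrite /mean card_ord /Sigma_MB mxE summxE; congr (_ * (_ * _)).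
by apply: eq_bigr => i _; rewrite mxE big_ord1 !mxE /p !mxE; ring.
Qed.

(** Bias-variance decomposition; the variance is the trace of the covariance
divided by the batch size, and each of its d diagonal entries is at most the
spectral norm. *)
Lemma mean_sqr_batch_grad_le (sigma2 : R) x : spectral_norm (Sigma_MB fs x) <= sigma2 ->
  mean (fun s => inner (batch_grad x s) (batch_grad x s)) <=
  inner (grad (avg fs) x) (grad (avg fs) x) + d%:R * sigma2 / n%:R.
Proof.
move=> sS; set G := grad (avg fs) x.
have E s : inner (batch_grad x s) (batch_grad x s) =
    (- inner G G + 2 * inner (batch_grad x s) G)
    + \sum_(c < d) (batch_grad x s - G) c 0 ^+ 2.
  have -> : \sum_(c < d) (batch_grad x s - G) c 0 ^+ 2 =
      inner (batch_grad x s - G) (batch_grad x s - G) by [].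
  by rewrite !(innerDl, innerDr, innerNl, innerNr) (innerC G (batch_grad _ _)); ring.
under eq_mean do rewrite E.
rewrite meanD meanD mean_cst ?meanZ; last by rewrite card_ffun expn_gt0 I0.
rewrite mean_inner_batch_grad mean_sum.
under eq_bigr do rewrite mean_sqr_batch_noise.
rewrite -mulr_sumr -/G.
have -> : - inner G G + 2 * inner G G = inner G G by ring.
rewrite lerD2l mulrC ler_wpM2r ?invr_ge0//.
rewrite -[X in X%:R * _](card_ord d) mulr_natl -sumr_const.
by apply: ler_sum => c _; exact: le_trans (diag_le_spectral_norm _ _) sS.
Qed.

End MiniBatch.

(** * Finitely valued random variables and histories of samples *)

Section FiniteValued.
Context {R : realType} {disp : measure_display} {T : measurableType disp}.
Variable P : probability T R.

Lemma measurable_preimage_seq (E : choiceType) (Y : T -> E) (s : seq E) (A : set E) :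
  (forall w, Y w \in s) -> (forall v, measurable (Y @^-1` [set v])) ->
  measurable (Y @^-1` A).
Proof.
move=> Ys mY.
have -> : Y @^-1` A = \big[setU/set0]_(v <- s | `[< A v >]) (Y @^-1` [set v]).
  apply/seteqP; split=> w /=; rewrite -bigcup_seq_cond/=.
    by move=> AY; exists (Y w) => //=; rewrite Ys; exact/asboolP.
  by move=> [v /= /andP[_ /asboolP Av] ->].
by apply: bigsetU_measurable.
Qed.

Lemma integral_finite_valued (E : choiceType) (Y : T -> E) (s : seq E) (g : E -> R) :
  uniq s -> (forall w, Y w \in s) -> (forall v, measurable (Y @^-1` [set v])) ->
  (forall v, 0 <= g v) ->
  (\int[P]_w (g (Y w))%:E = \sum_(v <- s) (g v)%:E * P (Y @^-1` [set v]))%E.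
Proof.
move=> us Ys mY g0.
transitivity (\int[P]_w (\sum_(v <- s) (g v)%:E * (\1_(Y @^-1` [set v]) w)%:E))%E.
  apply: eq_integral => w _; rewrite (bigD1_seq (Y w))//= big1 => [|v vY].
    by rewrite indicE mem_set// mule1 adde0.
  rewrite indicE memNset ?mule0// => /= Yw.
  by rewrite Yw eqxx in vY.
rewrite ge0_integral_sum//; last first.
- by move=> v w _; rewrite mule_ge0// lee_fin.
- move=> v; apply: measurable_funeM.
  exact/measurable_EFinP/measurable_indic.
apply: eq_bigr => v _; rewrite ge0_integralZl_EFin//.
- by rewrite integral_indic// setIT.
- exact/measurable_EFinP/measurable_indic.
Qed.

End FiniteValued.

(** A history records the mini-batches drawn before step k. Conditioning on the
past amounts to splitting off the last component of this nested product. *)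
Fixpoint history (N : nat) (b : nat -> nat) (k : nat) : finType :=
  if k is k'.+1 then (history N b k' * {ffun 'I_(b k') -> 'I_N})%type else unit.

Section Sampling.
Context {R : realType} {disp : measure_display} {T : measurableType disp}.
Context {N : nat} {b : nat -> nat}.
Variables (P : probability T R) (idx : forall k : nat, 'I_(b k) -> T -> 'I_N).

Fixpoint past (k : nat) (w : T) : history N b k :=
  if k is k'.+1 then (past k' w, [ffun j => idx (k := k') j w]) else tt.

Definition past_indices (k : nat) : seq {l : nat & 'I_(b l)} :=
  [seq Tagged (fun l => 'I_(b l)) j | l <- iota 0 k, j <- enum 'I_(b l)].

Definition past_event (k : nat) (c : forall l, {ffun 'I_(b l) -> 'I_N}) : set T :=
  \bigcap_(s in [set` seq_fset tt (past_indices k)])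
    (idx (tagged s) @^-1` [set c (tag s) (tagged s)]).

Lemma mem_past_indices k (s : {l : nat & 'I_(b l)}) :
  (s \in seq_fset tt (past_indices k)) = (tag s < k)%N.
Proof.
rewrite seq_fsetE; apply/idP/idP => [/allpairsPdep[l [j [lk _ ->]]]|].
  by rewrite mem_iota in lk.
case: s => l j /= lk; apply/allpairsPdep; exists l, j.
by rewrite mem_iota mem_enum.
Qed.

Lemma past_indices_uniq k : uniq (past_indices k).
Proof.
apply: allpairs_uniq_dep; first exact: iota_uniq.
  by move=> l _; exact: enum_uniq.
by move=> [? ?] [? ?] _ _.
Qed.

Lemma past_eventP k (c : forall l, {ffun 'I_(b l) -> 'I_N}) w :
  past_event k c w <-> (forall l j, (l < k)%N -> idx (k := l) j w = c l j).
Proof.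
split=> [cw l j lk|cw [l j]] /=; last by rewrite mem_past_indices; exact: cw.
by apply: (cw (Tagged (fun l => 'I_(b l)) j)); rewrite /= mem_past_indices.
Qed.

Hypotheses (N0 : (0 < N)%N) (iid : uniform_iid_sampling P idx).

Lemma measurable_idx l (j : 'I_(b l)) (A : set 'I_N) : measurable (idx j @^-1` A).
Proof. by case: iid => m _ _; apply: (m l j); exists A => //; rewrite setTI. Qed.

Lemma measurable_past_event k c : measurable (past_event k c).
Proof.
apply: fin_bigcap_measurable; first exact: finite_fset.
by move=> [l j] _; exact: measurable_idx.
Qed.

(** Joint independence makes the indices drawn before step k uniform over all
possible histories. *)
Lemma prob_past_event k c : P (past_event k c) = (#|history N b k|%:R^-1)%:E.
Proof.
have [_ unif indep] := iid.
rewrite /past_event indep; last first.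
  by move=> [l j] _; exists [set c l j] => //; rewrite setTI.
under eq_bigr => s _ do rewrite unif.
rewrite prodEFin; congr EFin.
rewrite (perm_big (past_indices k)) /=; last first.
  have := seq_fset_perm tt (past_indices k).
  by rewrite undup_id ?past_indices_uniq.
rewrite big_allpairs_dep.
elim: k => [|k ih]; first by rewrite big_nil card_unit invr1.
rewrite -addn1 iotaD big_cat/= ih big_seq1 big_enum prodr_const addn1/=.
by rewrite card_prod card_ffun natrM invfM natrX !card_ord exprVn.
Qed.

(** The family c prescribes indices for all steps, although only those before k
matter: a total family avoids indexing by the bounded dependent type of the
indices drawn so far. *)
Lemma past_preimage k (u : history N b k) :
  exists c, past k @^-1` [set u] = past_event k c.
Proof.
elim: k u => [[]|k ih [u s]].
  exists (fun l => [ffun=> Ordinal N0]); apply/seteqP; split=> w //= _.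
  exact/past_eventP.
have [c uE] := ih u.
exists (eqtype.dfwith (T := fun l => {ffun 'I_(b l) -> 'I_N}) c s); apply/seteqP; split=> w /=.
  move=> [wu ws]; apply/past_eventP => l j; rewrite ltnS leq_eqVlt => /predU1P[lk|lk].
    by subst l; rewrite dfwith_in -ws ffunE.
  rewrite dfwith_out ?gtn_eqF//.
  by have : past_event k c w by [rewrite -uE]; move/past_eventP; exact.
move=> /past_eventP cw; congr pair.
  suff : past_event k c w by rewrite -uE.
  apply/past_eventP => l j lk; rewrite cw ?(ltn_trans lk)//.
  by rewrite dfwith_out ?gtn_eqF.
by apply/ffunP => j; rewrite ffunE cw// dfwith_in.
Qed.

Lemma measurable_past k (A : set (history N b k)) : measurable (past k @^-1` A).
Proof.
apply: (@measurable_preimage_seq _ _ _ _ (enum (history N b k))) => [w|u].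
  by rewrite mem_enum.
by have [c ->] := past_preimage u; exact: measurable_past_event.
Qed.

Lemma integral_past k (g : history N b k -> R) : (forall u, 0 <= g u) ->
  (\int[P]_w (g (past k w))%:E = (mean g)%:E)%E.
Proof.
move=> g0; rewrite (@integral_finite_valued _ _ _ _ _ _ (enum (history N b k)))//.
- rewrite big_enum/= /mean mulr_sumr -sumEFin; apply: eq_bigr => u _.
  by have [c ->] := past_preimage u; rewrite prob_past_event muleC -EFinM.
- exact: enum_uniq.
- by move=> w; rewrite mem_enum.
- by move=> u; exact: measurable_past.
Qed.

End Sampling.

(** * Recursions for the mean gap and the mean squared distance *)

Section Iterates.
Context {R : realType} {d N : nat}.
Variables (fs : 'I_N -> 'cV[R]_d -> R) (b : nat -> nat) (eta : nat -> R).
Variable x0 : 'cV[R]_d.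

(** The iterates as functions of the history alone, free of the probability
space. *)
Fixpoint sgd_of_history (k : nat) : history N b k -> 'cV[R]_d :=
  if k is k'.+1 then
    fun u => sgd_of_history u.1 - eta k' *: batch_grad fs (sgd_of_history u.1) u.2
  else fun=> x0.

Lemma sgd_past disp (T : measurableType disp) (idx : forall k : nat, 'I_(b k) -> T -> 'I_N) k w :
  sgd fs idx eta x0 k w = sgd_of_history (past idx k w).
Proof.
elim: k => // k ih /=; rewrite -ih /G_MB /batch_grad.
by under [in RHS]eq_bigr do rewrite ffunE.
Qed.

Variables (xstar : 'cV[R]_d) (L tau sigma2 : R).
Hypotheses (N0 : (0 < N)%N) (L0 : 0 < L) (tau0 : 0 < tau).
Hypothesis fs_smooth : forall i, smooth L (fs i).
Hypothesis xstar_min : global_minimizer (avg fs) xstar.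
Hypothesis f_wqc : weakly_quasi_convex tau (avg fs) xstar.
Hypothesis sigma2_ub : forall x, spectral_norm (Sigma_MB fs x) <= sigma2.
Hypotheses (eta_gt0 : forall k, 0 < eta k) (b_gt0 : forall k, (0 < b k)%N).

Let f := avg fs.
Let noise (n : nat) : R := d%:R * sigma2 / n%:R.

Let fs_diff i x : differentiable (fs i) x. Proof. by case: (fs_smooth i). Qed.

Let batch_ord0 n : (0 < #|{: {ffun 'I_n -> 'I_N}}|)%N.
Proof. by rewrite card_ffun expn_gt0 card_ord N0. Qed.

Lemma mean_dist_step x n (a : R) : (0 < n)%N ->
  mean (fun s : {ffun 'I_n -> 'I_N} =>
      inner (x - a *: batch_grad fs x s - xstar) (x - a *: batch_grad fs x s - xstar))
  <= inner (x - xstar) (x - xstar) - 2 * a * inner (grad f x) (x - xstar)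
     + a ^+ 2 * (inner (grad f x) (grad f x) + noise n).
Proof.
move=> n0.
have E s : inner (x - a *: batch_grad fs x s - xstar)
      (x - a *: batch_grad fs x s - xstar) =
    inner (x - xstar) (x - xstar) + (- (2 * a)) * inner (batch_grad fs x s) (x - xstar)
    + a ^+ 2 * inner (batch_grad fs x s) (batch_grad fs x s).
  rewrite addrAC; move: (x - xstar) (batch_grad _ _ _) => y g.
  rewrite !(innerDl, innerDr, innerNl, innerNr, innerZl, innerZr) (innerC y g).
  by ring.
under eq_mean do rewrite E.
rewrite !meanD !meanZ mean_cst// mean_inner_batch_grad// mulNr lerD2l.
by rewrite ler_wpM2l ?sqr_ge0// mean_sqr_batch_grad_le.
Qed.

Lemma mean_value_step x n (a : R) : (0 < n)%N ->
  mean (fun s : {ffun 'I_n -> 'I_N} => f (x - a *: batch_grad fs x s) - f xstar)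
  <= f x - f xstar - a * inner (grad f x) (grad f x)
     + L / 2 * a ^+ 2 * (inner (grad f x) (grad f x) + noise n).
Proof.
move=> n0; have sf : smooth L f by exact: smooth_avg.
apply: (@le_trans _ _ (mean (fun s : {ffun 'I_n -> 'I_N} =>
    (f x - f xstar) + (- a) * inner (batch_grad fs x s) (grad f x)
    + (L / 2 * a ^+ 2) * inner (batch_grad fs x s) (batch_grad fs x s)))).
  apply: ler_mean => s; have := smooth_descent x (- (a *: batch_grad fs x s)) sf.
  move: (batch_grad fs x s) => g.
  by rewrite !(innerNl, innerNr, innerZl, innerZr) (innerC (grad f x)); lra.
rewrite meanD meanD !meanZ mean_cst// mean_inner_batch_grad// mulNr lerD2l.
rewrite ler_wpM2l ?mean_sqr_batch_grad_le//.
by rewrite mulr_ge0 ?sqr_ge0// divr_ge0// ltW.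
Qed.

Definition mean_gap k : R :=
  mean (fun u : history N b k => f (sgd_of_history u) - f xstar).

Definition mean_sqr_dist k : R :=
  mean (fun u : history N b k =>
    inner (sgd_of_history u - xstar) (sgd_of_history u - xstar)).

Lemma history_card_gt0 k : (0 < #|history N b k|)%N.
Proof. by elim: k => [|k ih] /=; rewrite ?card_unit// card_prod muln_gt0 ih batch_ord0. Qed.

Lemma mean_sqr_dist_ge0 k : 0 <= mean_sqr_dist k.
Proof.
rewrite mulr_ge0 ?invr_ge0//; apply: sumr_ge0 => u _; exact: inner_ge0.
Qed.

Lemma mean_sqr_dist0 : mean_sqr_dist 0 = enorm (x0 - xstar) ^+ 2.
Proof. by rewrite enorm_sqr -[RHS](@mean_cst _ unit) ?card_unit. Qed.

Lemma gap_ge0 x : 0 <= f x - f xstar.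
Proof. by rewrite subr_ge0. Qed.

(** Weak quasi-convexity decreases the squared distance by twice tau * eta k
times the gap. The squared gradient, at most 2 L times the gap, adds back no
more than half of this, since 2 * L * eta k <= tau. *)
Lemma mean_sqr_dist_step k : eta k <= tau / (2 * L) ->
  mean_sqr_dist k.+1 + tau * eta k * mean_gap k <=
  mean_sqr_dist k + eta k ^+ 2 * noise (b k).
Proof.
move=> hk; rewrite -lerBrDr /mean_sqr_dist mean_pair/=.
apply: (@le_trans _ _ (mean (fun u : history N b k =>
   inner (sgd_of_history u - xstar) (sgd_of_history u - xstar)
   + eta k ^+ 2 * noise (b k)
   + (- (tau * eta k)) * (f (sgd_of_history u) - f xstar)))); last first.
  by rewrite meanD meanD !meanZ mean_cst ?history_card_gt0// mulNr.
apply: ler_mean => u; set x := sgd_of_history u.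
apply: (le_trans (mean_dist_step x (eta k) (b_gt0 k))).
have H1 := f_wqc x.
have H2 := grad_sqr_le x L0 (smooth_avg N0 fs_smooth) xstar_min.
have e0 := eta_gt0 k.
have H3 : 2 * L * eta k <= tau.
  by rewrite mulrC -ler_pdivlMr// mulr_gt0.
rewrite -/f in H1 H2 *; have F0 := gap_ge0 x.
move: (inner (x - xstar) _) (inner (grad f x) (x - xstar)) H1 => D I H1.
move: (inner _ _) H2 => G H2; move: (f x - f xstar) F0 H1 H2 => F F0 H1 H2.
have : eta k * I >= eta k * (tau * F) by rewrite ler_wpM2l// ltW.
have : eta k ^+ 2 * G <= eta k ^+ 2 * (2 * L * F) by rewrite ler_wpM2l// sqr_ge0.
have : eta k * F * (2 * L * eta k) <= eta k * F * tau by rewrite ler_wpM2l// mulr_ge0// ltW.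
by move=> *; nra.
Qed.

Lemma sum_mean_gap_le k : (forall i, eta i <= tau / (2 * L)) ->
  tau * \sum_(i < k) eta i * mean_gap i <=
  enorm (x0 - xstar) ^+ 2 + \sum_(i < k) eta i ^+ 2 * noise (b i).
Proof.
move=> small.
suff : mean_sqr_dist k + tau * \sum_(i < k) eta i * mean_gap i <=
  enorm (x0 - xstar) ^+ 2 + \sum_(i < k) eta i ^+ 2 * noise (b i).
  by apply: le_trans; rewrite lerDr mean_sqr_dist_ge0.
elim: k => [|k ih]; first by rewrite !big_ord0 mulr0 !addr0 mean_sqr_dist0.
rewrite !big_ord_recr /=.
have := mean_sqr_dist_step (small k); lra.
Qed.

(** The time h * phi_k of the gradient flow that corresponds to k steps. *)
Definition elapsed k : R := \sum_(i < k) eta i.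

Lemma elapsed_ge0 k : 0 <= elapsed k.
Proof. by apply: sumr_ge0 => i _; exact: ltW. Qed.

Lemma elapsedS k : elapsed k.+1 = elapsed k + eta k.
Proof. exact: big_ord_recr. Qed.

(** The weight tau * elapsed of the gap grows by tau * eta k, which is what weak
quasi-convexity takes from half the squared distance. The descent of the gap,
whose weight tau * elapsed k.+1 is at least tau * eta k, absorbs the squared
gradient that the distance term creates. *)
Lemma lyapunov_step k : eta k <= 2 / L - 1 / (tau * L) ->
  tau * elapsed k.+1 * mean_gap k.+1 + mean_sqr_dist k.+1 / 2 <=
  tau * elapsed k * mean_gap k + mean_sqr_dist k / 2
  + (1 + tau * elapsed k.+1 * L) * (eta k ^+ 2 * noise (b k) / 2).
Proof.
move=> hk; set A := tau * elapsed k.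
have e0 := eta_gt0 k.
have A0 : 0 <= A by rewrite mulr_ge0 ?elapsed_ge0// ltW.
have -> : tau * elapsed k.+1 = A + tau * eta k by rewrite elapsedS mulrDr.
set B := A + tau * eta k.
have B0 : 0 <= B by rewrite addr_ge0// mulr_ge0// ltW.
rewrite /mean_gap /mean_sqr_dist !mean_pair/= ![_ / 2]mulrC -!meanZ -!meanD.
rewrite -[X in _ <= _ + X](mean_cst _ (history_card_gt0 k)) -meanD.
apply: ler_mean => u; set x := sgd_of_history u.
have V := ler_wpM2l B0 (mean_value_step x (eta k) (b_gt0 k)).
have D := mean_dist_step x (eta k) (b_gt0 k).
have H1 := f_wqc x.
(* the total coefficient of the squared gradient has the right sign *)
have gradient : 0 <= inner (grad f x) (grad f x) * eta k * (B * (1 - L / 2 * eta k) - eta k / 2).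
  apply: mulr_ge0; first by rewrite mulr_ge0 ?inner_ge0// ltW.
  (* the bound on the step size, in the form in which it is needed *)
  have c : 1 <= 2 * tau * (1 - L / 2 * eta k).
    have := ler_wpM2l (ltW (mulr_gt0 tau0 L0)) hk.
    have -> : tau * L * (2 / L - 1 / (tau * L)) = 2 * tau - 1.
      by field; rewrite !gt_eqF.
    lra.
  have p : 0 <= 1 - L / 2 * eta k.
    by rewrite -(pmulr_rge0 _ (mulr_gt0 (ltr0n R 2) tau0)) (le_trans ler01).
  rewrite /B; nra.
rewrite -/f in V D H1 *.
have := ler_wpM2l (ltW e0) H1.
move: (inner (x - xstar) _) (inner (grad f x) (x - xstar)) D => D I.
move: (inner _ _) gradient V => G gradient V.
move: (mean _) V => mV; move: (mean _) => mD.
rewrite /B in gradient *; lra.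
Qed.

Lemma elapsed_mean_gap_le k : (forall i, eta i <= 2 / L - 1 / (tau * L)) ->
  tau * elapsed k * mean_gap k <=
  enorm (x0 - xstar) ^+ 2 / 2
  + \sum_(i < k) (1 + tau * elapsed i.+1 * L) * (eta i ^+ 2 * noise (b i) / 2).
Proof.
move=> small.
suff : tau * elapsed k * mean_gap k + mean_sqr_dist k / 2 <=
    enorm (x0 - xstar) ^+ 2 / 2
    + \sum_(i < k) (1 + tau * elapsed i.+1 * L) * (eta i ^+ 2 * noise (b i) / 2).
  by apply: le_trans; rewrite lerDl divr_ge0 ?mean_sqr_dist_ge0.
elim: k => [|k ih].
  by rewrite /elapsed !big_ord0 mulr0 mul0r add0r addr0 mean_sqr_dist0.
rewrite big_ord_recr /=.
have := lyapunov_step (small k); lra.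
Qed.

End Iterates.

(** * Expectation at an independent random index *)

Section RandomIndexExpectation.
Context {R : realType} {disp : measure_display} {T : measurableType disp}.
Context {d : nat}.
Variables (P : probability T R) (eta : nat -> R) (x : nat -> T -> 'cV[R]_d).
Variable vals : nat -> seq 'cV[R]_d.
Hypothesis vals_uniq : forall k, uniq (vals k).
Hypothesis x_vals : forall k w, x k w \in vals k.
Hypothesis x_meas : forall k v, measurable (x k @^-1` [set v]).

Lemma sigma_process_preimage1 k v : sigma_process x (x k @^-1` [set v]).
Proof.
apply: sub_sigma_algebra; exists k => //; exists [set v]; last by rewrite setTI.
have -> : [set v] = setT `\` ~` [set v] by rewrite setDE setCK setTI.
apply: sigma_algebraCD; apply: sub_sigma_algebra; rewrite /= openC.
exact/accessible_closed_set1/hausdorff_accessible/norm_hausdorff.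
Qed.

(** The random index is independent of the sigma-algebra of the iterates, not of
the underlying history, so the integral is expanded over the values of the
iterates, whose level sets belong to that sigma-algebra. *)
Lemma integral_random_index k (ktilde : T -> 'I_k.+1) (g : 'cV[R]_d -> R) :
  random_index P eta x ktilde -> (forall v, 0 <= g v) ->
  (\int[P]_w (g (x (ktilde w) w))%:E =
   \sum_(j < k.+1) (psi eta j / phi eta k.+1)%:E * \int[P]_w (g (x j w))%:E)%E.
Proof.
move=> [kt_meas kt_law kt_indep] g0.
pose Y w := (ktilde w, x (ktilde w) w).
pose s := [seq (j, v) | j <- enum 'I_k.+1, v <- vals (nat_of_ord j)].
have YE j v : Y @^-1` [set (j, v)] = ktilde @^-1` [set j] `&` x j @^-1` [set v].
  apply/seteqP; split=> w /=; rewrite /Y; first by case=> <- <-.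
  by move=> [<- <-].
have kt_ev j : sigma_fin ktilde (ktilde @^-1` [set j]).
  by exists [set j] => //; rewrite setTI.
rewrite (@integral_finite_valued _ _ _ P _ Y s (fun e => g e.2))//.
- rewrite big_allpairs_dep big_enum/=; apply: eq_bigr => j _.
  rewrite (@integral_finite_valued _ _ _ P _ (x j) (vals j))//.
  rewrite ge0_sume_distrr; last by move=> v _; rewrite mule_ge0// lee_fin.
  apply: eq_bigr => v _; rewrite YE kt_indep//; last exact: sigma_process_preimage1.
  by rewrite kt_law muleCA.
- apply: allpairs_uniq_dep; first exact: enum_uniq.
    by move=> j _; exact: vals_uniq.
  by move=> [? ?] [? ?] _ _ [-> ->].
- by move=> w; apply/allpairsPdep; exists (ktilde w), (x (ktilde w) w); rewrite mem_enum.
- move=> [j v]; rewrite YE; apply: measurableI => //.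
  exact: kt_meas.
Qed.

End RandomIndexExpectation.

(** * Convergence of mini-batch SGD *)

Lemma elapsed_phi (R : realType) (eta : nat -> R) k : eta 0%N != 0 ->
  elapsed eta k = eta 0%N * phi eta k.
Proof.
move=> e0; rewrite /phi mulr_sumr; apply: eq_bigr => i _.
by rewrite /psi mulrCA mulfV ?mulr1.
Qed.

Lemma spectral_norm_le_sigma2_star (R : realType) (d N : nat)
    (fs : 'I_N -> 'cV[R]_d -> R) x :
  (sigma2_star fs < +oo)%E -> spectral_norm (Sigma_MB fs x) <= fine (sigma2_star fs).
Proof.
have le : ((spectral_norm (Sigma_MB fs x))%:E <= sigma2_star fs)%E.
  by apply: ereal_sup_ubound; exists x.
by move: le; case: (sigma2_star fs) => //= r; rewrite lee_fin.
Qed.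

Theorem theoremE2 (R : realType) (d N : nat)
  (fs : 'I_N -> 'cV[R]_d -> R) (xstar x0 : 'cV[R]_d) (L tau : R)
  (eta : nat -> R) (b : nat -> nat)
  (disp : measure_display) (T : measurableType disp) (P : probability T R)
  (idx : forall k : nat, 'I_(b k) -> T -> 'I_N)
  (d_gt0 : (0 < d)%N) (N_gt0 : (0 < N)%N)
  (fs_C1 : forall i, continuously_differentiable (fs i))
  (xstar_min : global_minimizer (avg fs) xstar)
  (L_gt0 : 0 < L)
  (fs_smooth : forall i, smooth L (fs i))
  (sigma2_fin : (sigma2_star fs < +oo)%E)
  (tau_gt0 : 0 < tau)
  (f_wqc : weakly_quasi_convex tau (avg fs) xstar)
  (eta_gt0 : forall k, 0 < eta k)
  (eta_noninc : forall m n, (m <= n)%N -> eta n <= eta m)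
  (b_gt0 : forall k, (0 < b k)%N)
  (idx_iid : uniform_iid_sampling P idx) :
  let f := avg fs in
  let h := eta 0%N in
  let x := sgd fs idx eta x0 in
  let sigma2 := fine (sigma2_star fs) in
  (h <= tau / (2 * L) ->
   forall (k : nat) (ktilde : T -> 'I_k.+1),
   random_index P eta x ktilde ->
   ('E_P[fun w => (f (x (ktilde w) w) - f xstar)%R] <=
    (enorm (x0 - xstar) ^+ 2 / (tau * (h * phi eta k.+1))
     + d%:R * h * sigma2 / (tau * (h * phi eta k.+1))
       * \sum_(i < k.+1) psi eta i ^+ 2 / (b i)%:R * h)%R%:E)%E)
  /\
  (h <= 2 / L - 1 / (tau * L) ->
   forall k : nat,
   ('E_P[fun w => (f (x k.+1 w) - f xstar)%R] <=
    (enorm (x0 - xstar) ^+ 2 / (2 * tau * (h * phi eta k.+1))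
     + h * d%:R * sigma2 / (2 * tau * (h * phi eta k.+1))
       * \sum_(i < k.+1)
           (1 + tau * (h * phi eta i.+1) * L) * (psi eta i ^+ 2 / (b i)%:R) * h)%R%:E)%E).
Proof.
move=> f h x sigma2.
have h0 : 0 < h by exact: eta_gt0.
have sub y : spectral_norm (Sigma_MB fs y) <= sigma2.
  exact: spectral_norm_le_sigma2_star.
have eta_le_h i : eta i <= h by exact: eta_noninc.
have phi_gt0 k : 0 < phi eta k.+1.
  rewrite /phi big_ord_recl ltr_pwDl ?divr_gt0//.
  by apply: sumr_ge0 => i _; rewrite divr_ge0// ltW.
have elapsedE k : elapsed eta k = h * phi eta k by rewrite elapsed_phi// gt_eqF.
have etaE i : eta i = h * psi eta i by rewrite /psi mulrCA mulfV ?mulr1// gt_eqF.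
have gap0 y : 0 <= f y - f xstar by rewrite subr_ge0.
have xE k w : x k w = sgd_of_history fs eta x0 (past idx k w) by exact: sgd_past.
have gapE k : (\int[P]_w (f (x k w) - f xstar)%:E =
    (mean_gap fs b eta x0 xstar k)%:E)%E.
  under eq_integral do rewrite xE.
  exact: (integral_past N_gt0 idx_iid
    (g := fun u => f (sgd_of_history fs eta x0 u) - f xstar)).
split=> [h_le k ktilde kt|h_le k]; rewrite expectation.unlock.
- have small i : eta i <= tau / (2 * L) by exact: le_trans h_le.
  pose vals j := undup [seq sgd_of_history fs eta x0 u | u <- enum (history N b j)].
  rewrite (@integral_random_index _ _ _ _ P eta x vals _ _ _ _ _
    (fun y => f y - f xstar) kt gap0).
  + under eq_bigr do rewrite gapE -EFinM.
    rewrite sumEFin lee_fin.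
    have M0 : 0 < tau * (h * phi eta k.+1) by rewrite !mulr_gt0.
    have := sum_mean_gap_le x0 N_gt0 L_gt0 fs_smooth xstar_min f_wqc sub
      eta_gt0 b_gt0 k.+1 small.
    rewrite -(ler_pM2l (etrans (invr_gt0 _) M0)).
    (* phi is itself a sum, into which mulr_sumr must not distribute *)
    move: (phi eta k.+1) (phi_gt0 k) {M0} => p p0.
    congr (_ <= _).
      rewrite !mulr_sumr; apply: eq_bigr => i _; rewrite etaE.
      by field; rewrite !gt_eqF.
    rewrite mulrDr mulrC; congr (_ + _); rewrite !mulr_sumr.
    apply: eq_bigr => i _; rewrite etaE.
    by field; rewrite !gt_eqF ?ltr0n.
  + by move=> j; exact: undup_uniq.
  + move=> j w; rewrite mem_undup xE; apply/mapP.
    by exists (past idx j w); rewrite ?mem_enum.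
  + move=> j v.
    have -> : x j @^-1` [set v] =
        past idx j @^-1` [set u | sgd_of_history fs eta x0 u = v].
      by apply/seteqP; split=> w /=; rewrite xE.
    exact: (measurable_past N_gt0 idx_iid).
- have small i : eta i <= 2 / L - 1 / (tau * L) by exact: le_trans h_le.
  rewrite gapE lee_fin.
  have M0 : 0 < tau * (h * phi eta k.+1) by rewrite !mulr_gt0.
  have := elapsed_mean_gap_le x0 N_gt0 L_gt0 tau_gt0 fs_smooth f_wqc sub
    eta_gt0 b_gt0 k.+1 small.
  rewrite elapsedE -(ler_pM2l (etrans (invr_gt0 _) M0)) mulKf ?gt_eqF//.
  move: (phi eta k.+1) (phi_gt0 k) {M0} => p p0.
  congr (_ <= _); rewrite mulrDr; congr (_ + _).
    by field; rewrite !gt_eqF.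
  rewrite !mulr_sumr; apply: eq_bigr => i _; rewrite elapsedE etaE.
  by field; rewrite !gt_eqF ?ltr0n.
Qed.
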